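(* For $n\ge0$ define $$P_n=\sum_{\sigma\in\mathfrak{D}_{2n}} x_1^{\mathrm{eareccpeak}(\sigma)}x_2^{\mathrm{eareccdfall}(\sigma)}y_1^{\mathrm{ereccval}(\sigma)}y_2^{\mathrm{ereccdrise}(\sigma)}u_1^{\mathrm{nrcpeak}(\sigma)}u_2^{\mathrm{nrcdfall}(\sigma)}v_1^{\mathrm{nrcval}(\sigma)}v_2^{\mathrm{nrcdrise}(\sigma)}w_{\mathrm e}^{\mathrm{evennrfix}(\sigma)}w_{\mathrm o}^{\mathrm{oddnrfix}(\sigma)}z_{\mathrm e}^{\mathrm{evenrar}(\sigma)}z_{\mathrm o}^{\mathrm{oddrar}(\sigma)}$$ $$\times\,p_{-1}^{\mathrm{lcrosscpeak}(\sigma)}p_{-2}^{\mathrm{lcrosscdfall}(\sigma)}p_{+1}^{\mathrm{ucrosscval}(\sigma)}p_{+2}^{\mathrm{ucrosscdrise}(\sigma)}q_{-1}^{\mathrm{lnestcpeak}(\sigma)}q_{-2}^{\mathrm{lnestcdfall}(\sigma)}q_{+1}^{\mathrm{unestcval}(\sigma)}q_{+2}^{\mathrm{unestcdrise}(\sigma)}s_{\mathrm e}^{\mathrm{epsnest}(\sigma)}s_{\mathrm o}^{\mathrm{opsnest}(\sigma)},$$ a polynomial in 22 variables. Then $\sum_{n\ge0}P_nt^n$ equals, as formal power series in $t$, the T-type continued fraction with coefficients $\alpha_{2k-1}=\bigl(p_{-1}^{k-1}x_1+q_{-1}[k-1]_{p_{-1},q_{-1}}u_1\bigr)\bigl(p_{+1}^{k-1}y_1+q_{+1}[k-1]_{p_{+1},q_{+1}}v_1\bigr)$,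 $\alpha_{2k}=\bigl(p_{-2}^{k-1}x_2+q_{-2}[k-1]_{p_{-2},q_{-2}}u_2+s_{\mathrm e}^kw_{\mathrm e}\bigr)\bigl(p_{+2}^{k-1}y_2+q_{+2}[k-1]_{p_{+2},q_{+2}}v_2+s_{\mathrm o}^kw_{\mathrm o}\bigr)$ for $k\ge1$, $\delta_1=z_{\mathrm e}z_{\mathrm o}$, $\delta_n=0$ for $n\ge2$.
   Context: For $n\ge0$, $\mathfrak{D}_{2n}$ is the set of permutations $\sigma$ of $[2n]$ with $\sigma(2k-1)\ge 2k-1$ and $\sigma(2k)\le 2k$ for all $k\in[n]$ (D-permutations). For an index $i$: cycle peak if $\sigma^{-1}(i)<i>\sigma(i)$, cycle valley if $\sigma^{-1}(i)>i<\sigma(i)$, cycle double rise if $\sigma^{-1}(i)<i<\sigma(i)$, cycle double fall if $\sigma^{-1}(i)>i>\sigma(i)$, fixed point if $\sigma(i)=i$. $i$ is a record if $\sigma(j)<\sigma(i)$ for all $j<i$, an antirecord if $\sigma(j)>\sigma(i)$ for all $j>i$; exclusive record = record but not antirecord; exclusive antirecord = antirecord but not record; record-antirecord = both; neither-record-antirecord = neither. $\mathrm{eareccpeak},\mathrm{eareccdfall}$ count exclusive antirecords that are cycle peaks, resp. cycle double falls; $\mathrm{ereccval},\mathrm{ereccdrise}$ count exclusive records that are cycle valleys, resp. cycle double rises; $\mathrm{nrcpeak},\mathrm{nrcdfall},\mathrm{nrcval},\mathrm{nrcdrise}$ count neither-record-antirecords that are cycle peaks, cycle double falls, cycle valleys,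 cycle double rises; $\mathrm{evennrfix},\mathrm{oddnrfix}$ count even/odd fixed points that are neither-record-antirecords; $\mathrm{evenrar},\mathrm{oddrar}$ count even/odd record-antirecords. Index-refined statistics: $\mathrm{ucross}(j,\sigma)=\#\{(i,k,l):i<j<k<l,\ k=\sigma(i),\ l=\sigma(j)\}$, $\mathrm{unest}(j,\sigma)=\#\{(i,k,l):i<j<k<l,\ k=\sigma(j),\ l=\sigma(i)\}$, $\mathrm{lcross}(k,\sigma)=\#\{(i,j,l):i<j<k<l,\ i=\sigma(k),\ j=\sigma(l)\}$, $\mathrm{lnest}(k,\sigma)=\#\{(i,j,l):i<j<k<l,\ i=\sigma(l),\ j=\sigma(k)\}$, and for a fixed point $j$, $\mathrm{psnest}(j,\sigma)=\#\{i<j:\sigma(i)>j\}$. Then $\mathrm{ucrosscval}(\sigma)=\sum_{j\text{ cycle valley}}\mathrm{ucross}(j,\sigma)$, $\mathrm{ucrosscdrise}(\sigma)=\sum_{j\text{ cycle double rise}}\mathrm{ucross}(j,\sigma)$, $\mathrm{lcrosscpeak}(\sigma)=\sum_{k\text{ cycle peak}}\mathrm{lcross}(k,\sigma)$, $\mathrm{lcrosscdfall}(\sigma)=\sum_{k\text{ cycle double fall}}\mathrm{lcross}(k,\sigma)$, and analogously $\mathrm{unestcval},\mathrm{unestcdrise},\mathrm{lnestcpeak},\mathrm{lnestcdfall}$ with unest/lnest; $\mathrm{epsnest}(\sigma)$ (resp. $\mathrm{opsnest}(\sigma)$) is the sum of $\mathrm{psnest}(i,\sigma)$ over even (resp. odd)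 fixed points $i$. For $n\ge0$, $[n]_{p,q}=\sum_{j=0}^{n-1}p^jq^{n-1-j}$ (so $[0]_{p,q}=0$). The T-type continued fraction with coefficients $(\alpha_n)_{n\ge1},(\delta_n)_{n\ge1}$ is the formal power series $1/(1-\delta_1t-\alpha_1t/(1-\delta_2t-\alpha_2t/(1-\delta_3t-\cdots)))$. *)

(* Defs.v *)
From mathcomp Require Import all_boot all_order all_algebra all_fingroup.

Set Implicit Arguments.
Unset Strict Implicit.
Unset Printing Implicit Defensive.

Import GRing.Theory.

(* A permutation of [N] = {1, .., N} is s : 'S_N; the element i : 'I_N stands
   for the index i.+1.  Only the parity of an index is affected by the shift. *)

Section Statistics.
Variable N : nat.
Implicit Types (s : 'S_N) (i j k l : 'I_N).

Definition even_idx i : bool := ~~ odd i.+1.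
Definition odd_idx i : bool := odd i.+1.

Definition Dperm s : bool :=
  [forall i : 'I_N, if odd_idx i then i <= s i else s i <= i].

Definition cpeak s i : bool := ((s^-1)%g i < i) && (s i < i).
Definition cval s i : bool := (i < (s^-1)%g i) && (i < s i).
Definition cdrise s i : bool := ((s^-1)%g i < i) && (i < s i).
Definition cdfall s i : bool := (i < (s^-1)%g i) && (s i < i).
Definition fix_ s i : bool := s i == i.

Definition record s i : bool := [forall j : 'I_N, (j < i) ==> (s j < s i)].
Definition antirecord s i : bool := [forall j : 'I_N, (i < j) ==> (s i < s j)].
Definition erec s i : bool := record s i && ~~ antirecord s i.
Definition earec s i : bool := antirecord s i && ~~ record s i.
Definition rar s i : bool := record s i && antirecord s i.
Definition nrar s i : bool := ~~ record s i && ~~ antirecord s i.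

Definition eareccpeak s := #|[set i : 'I_N | earec s i & cpeak s i]|.
Definition eareccdfall s := #|[set i : 'I_N | earec s i & cdfall s i]|.
Definition ereccval s := #|[set i : 'I_N | erec s i & cval s i]|.
Definition ereccdrise s := #|[set i : 'I_N | erec s i & cdrise s i]|.
Definition nrcpeak s := #|[set i : 'I_N | nrar s i & cpeak s i]|.
Definition nrcdfall s := #|[set i : 'I_N | nrar s i & cdfall s i]|.
Definition nrcval s := #|[set i : 'I_N | nrar s i & cval s i]|.
Definition nrcdrise s := #|[set i : 'I_N | nrar s i & cdrise s i]|.
Definition evennrfix s := #|[set i : 'I_N | [&& even_idx i, fix_ s i & nrar s i]]|.
Definition oddnrfix s := #|[set i : 'I_N | [&& odd_idx i, fix_ s i & nrar s i]]|.
Definition evenrar s := #|[set i : 'I_N | even_idx i & rar s i]|.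
Definition oddrar s := #|[set i : 'I_N | odd_idx i & rar s i]|.

Definition ucross j s := #|[set t : 'I_N * 'I_N * 'I_N |
  let: (i, k, l) := t in [&& i < j, j < k, k < l, k == s i & l == s j]]|.
Definition unest j s := #|[set t : 'I_N * 'I_N * 'I_N |
  let: (i, k, l) := t in [&& i < j, j < k, k < l, k == s j & l == s i]]|.
Definition lcross k s := #|[set t : 'I_N * 'I_N * 'I_N |
  let: (i, j, l) := t in [&& i < j, j < k, k < l, i == s k & j == s l]]|.
Definition lnest k s := #|[set t : 'I_N * 'I_N * 'I_N |
  let: (i, j, l) := t in [&& i < j, j < k, k < l, i == s l & j == s k]]|.
Definition psnest j s := #|[set i : 'I_N | i < j & j < s i]|.

Definition ucrosscval s := \sum_(j | cval s j) ucross j s.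
Definition ucrosscdrise s := \sum_(j | cdrise s j) ucross j s.
Definition lcrosscpeak s := \sum_(k | cpeak s k) lcross k s.
Definition lcrosscdfall s := \sum_(k | cdfall s k) lcross k s.
Definition unestcval s := \sum_(j | cval s j) unest j s.
Definition unestcdrise s := \sum_(j | cdrise s j) unest j s.
Definition lnestcpeak s := \sum_(k | cpeak s k) lnest k s.
Definition lnestcdfall s := \sum_(k | cdfall s k) lnest k s.
Definition epsnest s := \sum_(i | even_idx i && fix_ s i) psnest i s.
Definition opsnest s := \sum_(i | odd_idx i && fix_ s i) psnest i s.

End Statistics.

Local Open Scope ring_scope.

Definition pq_nat (R : comNzRingType) (p q : R) (n : nat) : R :=
  \sum_(j < n) p ^+ j * q ^+ (n - 1 - j).

Section TFraction.
Variable R : comNzRingType.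

(* The formal power series \sum_n (f n) t^n. *)
Definition fps := nat -> R.
Implicit Types f g : fps.

Definition fps0 : fps := fun=> 0.
Definition fps1 : fps := fun n => (n == 0%N)%:R.
Definition fps_sub f g : fps := fun n => f n - g n.
Definition fps_mul f g : fps := fun n => \sum_(i < n.+1) f i * g (n - i)%N.
Definition fps_exp f k : fps := iter k (fps_mul f) fps1.

(* 1 / (1 - g) = \sum_k g^k, meaningful when g has zero constant term: then
   only the terms k <= n contribute to the coefficient of t^n. *)
Definition fps_geom g : fps := fun n => \sum_(k < n.+1) fps_exp g k n.

Lemma fps_exp_lt g k n : g 0%N = 0 -> (n < k)%N -> fps_exp g k n = 0.
Proof.
move=> g0; elim: k n => // k IHk n; rewrite ltnS => le_nk.
rewrite /fps_exp iterS -/(fps_exp g k) /fps_mul big1 // => -[[|i] lt_in] _ /=.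
  by rewrite g0 mul0r.
rewrite IHk ?mulr0 //; apply: leq_trans le_nk.
by rewrite ltnS in lt_in; rewrite ltn_subrL (leq_ltn_trans _ lt_in).
Qed.

Lemma fps_geomP g : g 0%N = 0 ->
  fps_mul (fps_sub fps1 g) (fps_geom g) =1 fps1.
Proof.
move=> g0 n; rewrite /fps_mul.
have geomE m : (m <= n)%N -> fps_geom g m = \sum_(k < n.+1) fps_exp g k m.
  move=> le_mn; rewrite /fps_geom -!(big_mkord xpredT (fun k => fps_exp g k m)).
  rewrite [RHS](big_cat_nat (n := m.+1)) //= [X in _ + X]big_nat_cond.
  by rewrite [X in _ + X]big1 ?addr0 // => k /andP[/andP[lt_mk _] _]; apply: fps_exp_lt.
under eq_bigr => i _ do rewrite geomE ?leq_subr // mulrBl.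
rewrite sumrB.
have -> : \sum_(i < n.+1) fps1 i * \sum_(k < n.+1) fps_exp g k (n - i)%N =
          \sum_(k < n.+1) fps_exp g k n.
  rewrite big_ord_recl [X in _ + X]big1 => [|i _]; last by rewrite /fps1 mul0r.
  by rewrite /fps1 mul1r subn0 addr0.
under [X in _ - X]eq_bigr => i _ do rewrite mulr_sumr.
rewrite exchange_big /= -sumrB -(big_mkord xpredT
  (fun k => fps_exp g k n - fps_exp g k.+1 n)).
under eq_bigr => k _ do rewrite -opprB.
by rewrite sumrN telescope_sumr // opprB (fps_exp_lt (k := n.+1)) // subr0.
Qed.

(* d t + a t f *)
Definition fps_step (d a : R) f : fps :=
  fun n => if n is m.+1 then d * fps1 m + a * f m else 0.

(* 1/(1 - d_m t - a_m t/(1 - d_{m+1} t - a_{m+1} t/( ... ))), cut off (tail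
   replaced by 0) after K levels. *)
Fixpoint Tconvergent (a d : nat -> R) (K m : nat) : fps :=
  if K is K'.+1 then
    fps_geom (fps_step (d m) (a m) (Tconvergent a d K' m.+1))
  else fps0.

(* Limit in the t-adic topology. *)
Definition fps_cvg (F : nat -> fps) f : Prop :=
  forall n, exists K0, forall K, (K0 <= K)%N -> F K n = f n.

(* \sum_n (f n) t^n is the T-fraction with coefficients (a_n)_{n >= 1} and
   (d_n)_{n >= 1}; the values a 0 and d 0 are not used. *)
Definition is_Tfraction (a d : nat -> R) f : Prop :=
  fps_cvg (fun K => Tconvergent a d K 1) f.

End TFraction.

(* Main.v *)
Require Import Defs.
From mathcomp Require Import all_boot all_order all_algebra all_fingroup.
From mathcomp Require Import zify ring.

(* Scan the indices i of a permutation s from left to right and let the height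
   be the number of a < i with s(a) >= i.  The type of i (cycle valley, peak,
   double rise, double fall, fixed point) moves the height, and i gets as label
   the number of its nestings; crossings are what is missing from the height,
   and an excedance is a record iff it has no nestings (dually for
   antirecords), so every statistic is local in the type, the label and the
   height.  A permutation is determined by its types and labels: the lower arcs
   are recovered from left to right and the upper arcs from right to left.
   There are N! admissible codes of length N (n! 'C(n, h) of length n from height
   h), hence every code comes from a permutation, and
   summing over the labels turns P_n into a sum over weighted lattice paths.

   A D-permutation has its double rises, valleys and odd fixed points at odd
   indices, and the others at even indices.  Giving height h the level 2h after
   an even index and 2h - 1 after an odd one yields Dyck paths, except for the
   step 0, -1, 0 given by two record-antirecords: it accounts for delta_1. *)

Set Implicit Arguments.
Unset Strict Implicit.
Unset Printing Implicit Defensive.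

Import GRing.Theory.

(** * Heights, crossings and nestings *)

Section PermHeights.
Variable N : nat.
Implicit Types (s : 'S_N) (i j k l : 'I_N).

(** The argument is a natural number, not an index, so that the cut after the last index is covered
    too ([heightN]). *)
Definition height s (k : nat) := #|[set a : 'I_N | (a < k) && (k <= s a)]|.

(** The arguments below [k] and the values below [k] are equally many, so as many arcs cross the cut
    upwards as downwards. *)
Lemma height_lower s (k : nat) :
  #|[set a : 'I_N | (k <= a) && (s a < k)]| = height s k.
Proof.
have cardE : #|[set a : 'I_N | s a < k]| = #|[set a : 'I_N | a < k]|.
  rewrite -(card_imset _ (@perm_inj _ s)); apply: eq_card => v.
  apply/imsetP/idP => [[a]|]; rewrite !inE; first by move=> lt_sak ->.
  by move=> lt_vk; exists ((s^-1)%g v); rewrite ?inE permKV.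
have:= cardsID [set a : 'I_N | a < k] [set a : 'I_N | s a < k].
have:= cardsID [set a : 'I_N | s a < k] [set a : 'I_N | a < k].
rewrite setIC cardE => /[swap] <- /addnI eqD.
have -> : height s k = #|[set a : 'I_N | a < k] :\: [set a : 'I_N | s a < k]|.
  by apply: eq_card => a; rewrite !inE -leqNgt andbC.
by rewrite eqD; apply: eq_card => a; rewrite !inE -leqNgt.
Qed.

Lemma eq_permV s i j : (s j == i) = (j == (s^-1)%g i).
Proof. by rewrite -(inj_eq (@perm_inj _ s^-1)) permK. Qed.

(** Among the upper arcs that cross the cut before [i], only the one ending at [i] does not pass
    over [i]. *)
Lemma height_open s i :
  height s i = #|[set a : 'I_N | (a < i) && (i < s a)]| + ((s^-1)%g i < i).
Proof.
rewrite /height -(cardsID [set a | s a == i]) addnC; congr (_ + _).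
  apply: eq_card => a; rewrite !inE -val_eqE /= andbC -andbA; congr (_ && _).
  by rewrite [i < s a]ltn_neqAle eq_sym andbC.
case: ltnP => [lt_i|le_i].
  rewrite (_ : _ :&: _ = [set (s^-1)%g i]) ?cards1 //; apply/setP=> a.
  rewrite !inE eq_permV; case: eqP => [->|]; last by rewrite andbF.
  by rewrite lt_i permKV leqnn.
apply: eq_card0 => a; rewrite !inE eq_permV; case: eqP => [->|]; last by rewrite andbF.
by rewrite ltnNge le_i.
Qed.

Lemma height_succ s i :
  height s i.+1 = #|[set a : 'I_N | (a < i) && (i < s a)]| + (i < s i).
Proof.
rewrite /height -(cardsID [set i]) addnC; congr (_ + _).
  apply: eq_card => a; rewrite !inE ltnS -val_eqE /= andbA; congr (_ && _).
  by rewrite ltn_neqAle.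
case: ltnP => [lt_i|le_i].
  rewrite (_ : _ :&: _ = [set i]) ?cards1 //; apply/setP=> a.
  by rewrite !inE; case: eqP => [->|]; rewrite ?andbF // ltnS leqnn lt_i.
apply: eq_card0 => a; rewrite !inE; case: eqP => [->|]; last by rewrite andbF.
by rewrite [i < s i]ltnNge le_i !andbF.
Qed.

Lemma lower_height s i :
  height s i = #|[set a : 'I_N | (i < a) && (s a < i)]| + (s i < i).
Proof.
rewrite -height_lower -(cardsID [set i]) addnC; congr (_ + _).
  apply: eq_card => a; rewrite !inE -val_eqE /= andbA; congr (_ && _).
  by rewrite ltn_neqAle eq_sym.
case: ltnP => [lt_i|le_i].
  rewrite (_ : _ :&: _ = [set i]) ?cards1 //; apply/setP=> a.
  by rewrite !inE; case: eqP => [->|]; rewrite ?andbF // leqnn lt_i.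
apply: eq_card0 => a; rewrite !inE; case: eqP => [->|]; last by rewrite andbF.
by rewrite [s i < i]ltnNge le_i !andbF.
Qed.

Lemma height_step s i :
  height s i.+1 + ((s^-1)%g i < i) = height s i + (i < s i).
Proof. by rewrite height_succ height_open addnAC. Qed.

Lemma height0 s : height s 0 = 0.
Proof. by apply: eq_card0 => a; rewrite !inE. Qed.

Lemma heightN s : height s N = 0.
Proof. by apply: eq_card0 => a; rewrite !inE [N <= s a]leqNgt (ltn_ord (s a)) andbF. Qed.

Lemma unestE s j : j < s j ->
  unest j s = #|[set i : 'I_N | (i < j) && (s j < s i)]|.
Proof.
move=> lt_j; rewrite -(card_imset _ (_ : injective (fun i => (i, s j, s i)))).
  apply: eq_card => -[[i k] l]; apply/idP/imsetP; rewrite !inE.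
    case/and5P=> ij jk kl /eqP dk /eqP dl; exists i; last by rewrite dk dl.
    by rewrite inE ij -dk -dl.
  by case=> a; rewrite inE => /andP[aj saj] [-> -> ->]; rewrite aj lt_j saj !eqxx.
by move=> i i' [].
Qed.

Lemma ucrossE s j : j < s j ->
  ucross j s = #|[set i : 'I_N | [&& i < j, j < s i & s i < s j]]|.
Proof.
move=> lt_j; rewrite -(card_imset _ (_ : injective (fun i => (i, s i, s j)))).
  apply: eq_card => -[[i k] l]; apply/idP/imsetP; rewrite !inE.
    case/and5P=> ij jk kl /eqP dk /eqP dl; exists i; last by rewrite dk dl.
    by rewrite inE ij -dk -dl jk.
  by case=> a; rewrite inE => /and3P[aj jsa saj] [-> -> ->]; rewrite aj jsa saj !eqxx.
by move=> i i' [].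
Qed.

Lemma lnestE s k : s k < k ->
  lnest k s = #|[set l : 'I_N | (k < l) && (s l < s k)]|.
Proof.
move=> lt_k; rewrite -(card_imset _ (_ : injective (fun l => (s l, s k, l)))).
  apply: eq_card => -[[i j] l]; apply/idP/imsetP; rewrite !inE.
    case/and5P=> ij jk kl /eqP di /eqP dj; exists l; last by rewrite di dj.
    by rewrite inE kl -di -dj.
  by case=> a; rewrite inE => /andP[aj saj] [-> -> ->]; rewrite aj lt_k saj !eqxx.
by move=> i i' [].
Qed.

Lemma lcrossE s k : s k < k ->
  lcross k s = #|[set l : 'I_N | [&& k < l, s l < k & s k < s l]]|.
Proof.
move=> lt_k; rewrite -(card_imset _ (_ : injective (fun l => (s k, s l, l)))).
  apply: eq_card => -[[i j] l]; apply/idP/imsetP; rewrite !inE.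
    case/and5P=> ij jk kl /eqP di /eqP dj; exists l; last by rewrite di dj.
    by rewrite inE kl -di -dj jk.
  case=> a; rewrite inE => /and3P[ka sak ksa] [-> -> ->].
  by rewrite ka sak ksa !eqxx.
by move=> i i' [].
Qed.

(** Upper arcs passing over [i] nest or cross the arc of [i] according to the order of [s a] and
    [s i], which differ by injectivity; the arc ending at [i] does neither. *)
Lemma unest_ucross s i : i < s i ->
  unest i s + ucross i s + ((s^-1)%g i < i) = height s i.
Proof.
move=> lt_i; rewrite height_open unestE // ucrossE //; congr (_ + _).
rewrite -(cardsID [set a | s i < s a] [set a : 'I_N | (a < i) && (i < s a)]).
congr (_ + _); apply: eq_card => a; rewrite !inE.
  apply/idP/idP => [/andP[-> lt_s]|/andP[/andP[-> _] ->]//].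
  by rewrite lt_s (ltn_trans lt_i lt_s).
rewrite -leqNgt [s a <= _]leq_eqVlt val_eqE (inj_eq perm_inj) -val_eqE.
by case: ltngtP; rewrite ?andbF //= andbC.
Qed.

(** The dual split for lower arcs; the successor accounts for the arc of [i] itself, which
    [lower_height] counts. *)
Lemma lnest_lcross s i : s i < i ->
  (lnest i s + lcross i s).+1 = height s i.
Proof.
move=> lt_i; rewrite lower_height lt_i addn1 lnestE // lcrossE //; congr _.+1.
rewrite -(cardsID [set a | s a < s i] [set a : 'I_N | (i < a) && (s a < i)]).
congr (_ + _); apply: eq_card => a; rewrite !inE.
  apply/idP/idP => [/andP[-> lt_s]|/andP[/andP[-> _] ->]//].
  by rewrite lt_s (ltn_trans lt_s lt_i).
rewrite -leqNgt [s i <= _]leq_eqVlt val_eqE (inj_eq perm_inj) -val_eqE.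
by case: ltngtP; rewrite ?andbF //= andbC.
Qed.

Lemma psnest_height s i : s i = i -> psnest i s = height s i.
Proof.
move=> fix_i; have fixV : (s^-1)%g i = i by rewrite -{1}fix_i permK.
by rewrite height_open fixV ltnn addn0.
Qed.

Lemma exc_record s i : i < s i -> record s i = (unest i s == 0).
Proof.
move=> lt_i; rewrite unestE // cards_eq0; apply/forallP/eqP => [rec_i|eq0 a].
  apply/setP=> a; rewrite !inE; apply: contraTF (rec_i a).
  by case/andP=> -> lt_s; rewrite -leqNgt ltnW.
apply/implyP=> lt_a; have/setP/(_ a) := eq0; rewrite !inE lt_a /=.
case: ltngtP => // /val_inj/perm_inj eq_ia.
by move: lt_a; rewrite eq_ia ltnn.
Qed.

(** The arc of [i] makes the height after [i] positive, so by [height_lower] some lower arc crosses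
    that cut; it starts right of [i] and ends at or before [i]. *)
Lemma exc_antirecord s i : i < s i -> antirecord s i = false.
Proof.
move=> lt_i; have: 0 < height s i.+1 by rewrite height_succ lt_i addn1.
rewrite -height_lower => /card_gt0P[a]; rewrite inE => /andP[lt_ia le_sa].
apply/forallP=> /(_ a); rewrite lt_ia /= => lt_s.
by move: (leq_trans lt_s le_sa); rewrite ltnNge ltnW.
Qed.

Lemma aexc_antirecord s i : s i < i -> antirecord s i = (lnest i s == 0).
Proof.
move=> lt_i; rewrite lnestE // cards_eq0; apply/forallP/eqP => [rec_i|eq0 a].
  apply/setP=> a; rewrite !inE; apply: contraTF (rec_i a).
  by case/andP=> -> lt_s; rewrite -leqNgt ltnW.
apply/implyP=> lt_a; have/setP/(_ a) := eq0; rewrite !inE lt_a /=.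
case: ltngtP => // /val_inj/perm_inj eq_ia.
by move: lt_a; rewrite eq_ia ltnn.
Qed.

Lemma aexc_record s i : s i < i -> record s i = false.
Proof.
move=> lt_i; have: 0 < height s i by rewrite lower_height lt_i addn1.
case/card_gt0P=> a; rewrite inE => /andP[lt_ai le_isa].
apply/forallP=> /(_ a); rewrite lt_ai /= => lt_s.
by move: (ltn_trans lt_i (leq_ltn_trans le_isa lt_s)); rewrite ltnn.
Qed.

Lemma fix_record s i : s i = i -> record s i = (height s i == 0).
Proof.
move=> fix_i; rewrite /record /height fix_i cards_eq0.
apply/forallP/eqP => [rec_i|eq0 a].
  by apply/setP=> a; rewrite !inE; move: (rec_i a); case: ltnP => //= _ /ltn_geF.
by apply/implyP=> lt_a; have/setP/(_ a) := eq0; rewrite !inE lt_a /= ltnNge => ->.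
Qed.

Lemma fix_antirecord s i : s i = i -> antirecord s i = (height s i == 0).
Proof.
move=> fix_i; rewrite /antirecord lower_height fix_i ltnn addn0 cards_eq0.
apply/forallP/eqP => [rec_i|eq0 a].
  apply/setP=> a; rewrite !inE; move: (rec_i a).
  by case: ltnP => //= _ /ltnW; rewrite ltnNge => ->.
apply/implyP=> lt_a; have/setP/(_ a) := eq0; rewrite !inE lt_a /=.
case: ltngtP => // /val_inj eq_ia _.
move: lt_a; rewrite (_ : a = i) ?ltnn //.
by apply: (@perm_inj _ s); rewrite fix_i.
Qed.
End PermHeights.

(** * Encoding permutations by types and labels *)

(* [Some (closes, opens)] says whether an upper arc ends, resp. starts, at the
   index, [None] that it is fixed; the second component is the label. *)
Definition step : Type := option (bool * bool) * nat.

Definition next_height (h : nat) (x : step) : nat :=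
  if x.1 is Some (closes, opens) then h + opens - closes else h.

(** In order: valley, double rise, peak, double fall, fixed point. The label ranges are those that
    [unest_ucross] and [lnest_lcross] allow at height [h]. *)
Definition steps (h : nat) : seq step :=
  [seq (Some (false, true), l) | l <- index_iota 0 h.+1] ++
  [seq (Some (true, true), l) | l <- index_iota 0 h] ++
  [seq (Some (true, false), l) | l <- index_iota 0 h] ++
  [seq (Some (false, false), l) | l <- index_iota 0 h] ++ [:: (None, 0)].

Fixpoint codes (n h : nat) : seq (seq step) :=
  if n is n'.+1 then
    [seq x :: c | x <- steps h, c <- codes n' (next_height h x)]
  else if h == 0 then [:: [::]] else [::].

Lemma big_steps (T : Type) (idx : T) (op : Monoid.com_law idx) h (F : step -> T) :
  \big[op/idx]_(x <- steps h) F x =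
  op (\big[op/idx]_(l < h.+1) F (Some (false, true), val l))
  (op (\big[op/idx]_(l < h) F (Some (true, true), val l))
  (op (\big[op/idx]_(l < h) F (Some (true, false), val l))
  (op (\big[op/idx]_(l < h) F (Some (false, false), val l)) (F (None, 0))))).
Proof.
by rewrite !big_cat !big_map !big_mkord /= big_seq1.
Qed.

Lemma mem_steps h (x : step) :
  (if x is (Some (closes, opens), l) then l < h + (~~ closes && opens)
   else x.2 == 0) -> x \in steps h.
Proof.
have mem_labels (t : option (bool * bool)) m l :
    l < m -> (t, l) \in [seq (t, l') | l' <- index_iota 0 m].
  by move=> lt_lm; apply: map_f; rewrite mem_index_iota.
case: x => [[[[] []]|] l] /=; rewrite ?addn0 ?addn1 !mem_cat.
- by move/mem_labels->; rewrite ?orbT.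
- by move/mem_labels->; rewrite ?orbT.
- by move/mem_labels->; rewrite ?orbT.
- by move/mem_labels->; rewrite ?orbT.
by move/eqP->; rewrite !orbT.
Qed.

Lemma codesS n h :
  codes n.+1 h =
  flatten [seq [seq x :: c | c <- codes n (next_height h x)] | x <- steps h].
Proof. by []. Qed.

Lemma cons_codes n h (x : step) (c : seq step) :
  x \in steps h -> c \in codes n (next_height h x) -> x :: c \in codes n.+1 h.
Proof.
by move=> h_x x_c; rewrite codesS; apply/flatten_mapP; exists x => //; apply: map_f.
Qed.

(** Splitting off the first step reduces the claim to (h+1) C(n,h+1) + (2h+1) C(n,h) + h C(n,h-1) =
    (n+1) C(n+1,h). *)
Lemma size_codes n h : size (codes n h) = n`! * 'C(n, h).
Proof.
elim: n h => [|n IHn] h; first by case: h.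
have -> : size (codes n.+1 h) =
    sumn [seq size (codes n (next_height h x)) | x <- steps h].
  exact: size_allpairs_dep.
rewrite sumnE big_map big_steps /=.
rewrite /next_height /= !sum_nat_const !card_ord !IHn.
rewrite !addn0 !addn1 !subn0 !subn1 /=.
case: h => [|h]; first by rewrite !bin0 !bin1 factS; lia.
(* By Pascal's rule the left side is (h+1) C(n+1,h+1) + h C(n+1,h); the two diagonal identities turn
   it into (n+1) (C(n,h) + C(n,h-1)), with [h.+1] in the place of h. *)
have diag1 := mul_bin_diag n.+1 h.
have diag2 := mul_bin_diag n.+1 h.+1.
rewrite /= !binS in diag1 diag2.
rewrite !binS factS /=.
have := congr1 (muln n`!) diag1; have := congr1 (muln n`!) diag2; lia.
Qed.

(** * Reconstruction of a permutation from its types and labels *)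

Section PermCode.
Variable N : nat.
Implicit Types (s t : 'S_N) (i j k l : 'I_N).

Definition perm_step s i : step :=
  if s i == i then (None, 0)
  else (Some ((s^-1)%g i < i, i < s i), if i < s i then unest i s else lnest i s).

Definition code s := [seq perm_step s i | i <- enum 'I_N].

(** Counting by values instead of arguments makes the nestings of two permutations comparable by
    inclusion of sets of values. *)
Lemma unestVE s j : j < s j ->
  unest j s = #|[set v : 'I_N | ((s^-1)%g v < j) && (s j < v)]|.
Proof.
move=> lt_j; rewrite unestE // -[RHS](card_imset _ (@perm_inj _ s^-1)).
apply: eq_card => a; rewrite inE; apply/idP/imsetP => [aP|[v]].
  by exists (s a); rewrite ?inE permK.
by rewrite inE => vP ->; rewrite permKV.
Qed.

Lemma lnestVE s k : s k < k ->
  lnest k s = #|[set v : 'I_N | (k < (s^-1)%g v) && (v < s k)]|.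
Proof.
move=> lt_k; rewrite lnestE // -[RHS](card_imset _ (@perm_inj _ s^-1)).
apply: eq_card => a; rewrite inE; apply/idP/imsetP => [aP|[v]].
  by exists (s a); rewrite ?inE permK.
by rewrite inE => vP ->; rewrite permKV.
Qed.

(* If s and t have the same types and agree on the lower arcs before k, the same
   values are available to both at k, so [lnest] increases with the value. *)
Lemma ltn_lnest s t k :
    (forall v : 'I_N, v < (s^-1)%g v -> v < (t^-1)%g v) ->
    (forall j : 'I_N, j < k -> t j < j -> s j = t j) ->
  s k < t k -> t k < k -> lnest k s < lnest k t.
Proof.
move=> sub_st eq_st lt_st lt_tk.
(* A value not taken by [s] before [k] is not taken by [t] either: the lower arc of [t] reaching it
   would be an arc of [s]. *)
have avail (v : 'I_N) : v < k -> k <= (s^-1)%g v -> k <= (t^-1)%g v.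
  move=> lt_vk le_k; have lt_v := sub_st v (leq_trans lt_vk le_k).
  rewrite leqNgt; apply/negP => lt_tv.
  have := eq_st _ lt_tv; rewrite permKV => /(_ lt_v) eq_v.
  by move: lt_tv; rewrite ltnNge -[X in _ <= val X](permK s) eq_v le_k.
have lt_sk := ltn_trans lt_st lt_tk.
have strict (v : 'I_N) : v < t k -> k <= (t^-1)%g v -> k < (t^-1)%g v.
  move=> lt_v; rewrite leq_eqVlt => /orP[/eqP/val_inj eq_k|//].
  by move: lt_v; rewrite eq_k permKV ltnn.
rewrite !lnestVE // proper_card //; apply/properP; split.
  apply/subsetP=> v; rewrite !inE => /andP[lt_k lt_v].
  have lt_vt := ltn_trans lt_v lt_st; rewrite lt_vt andbT strict //.
  exact: avail (ltn_trans lt_vt lt_tk) (ltnW lt_k).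
(* The value [s k] makes the inclusion strict: it is still available to [t] at [k] and lies below
   [t k]. *)
exists (s k); rewrite !inE ?ltnn ?andbF // lt_st andbT.
by rewrite strict // avail // permK.
Qed.

(** Mirror image of [ltn_lnest]: the upper arcs agree after [k], and a smaller value at [k] has more
    nestings. *)
Lemma ltn_unest s t k :
    (forall v : 'I_N, (s^-1)%g v < v -> (t^-1)%g v < v) ->
    (forall j : 'I_N, k < j -> j < t j -> s j = t j) ->
  t k < s k -> k < t k -> unest k s < unest k t.
Proof.
move=> sub_st eq_st lt_st lt_tk.
have avail (v : 'I_N) : k < v -> (s^-1)%g v <= k -> (t^-1)%g v <= k.
  move=> lt_vk le_k; have lt_v := sub_st v (leq_ltn_trans le_k lt_vk).
  rewrite leqNgt; apply/negP => lt_tv.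
  have := eq_st _ lt_tv; rewrite permKV => /(_ lt_v) eq_v.
  by move: lt_tv; rewrite ltnNge -[X in val X <= _](permK s) eq_v le_k.
have lt_sk := ltn_trans lt_tk lt_st.
have strict (v : 'I_N) : t k < v -> (t^-1)%g v <= k -> (t^-1)%g v < k.
  move=> lt_v; rewrite leq_eqVlt => /orP[/eqP/val_inj eq_k|//].
  by move: lt_v; rewrite -eq_k permKV ltnn.
rewrite !unestVE // proper_card //; apply/properP; split.
  apply/subsetP=> v; rewrite !inE => /andP[lt_k lt_v].
  have lt_vt := ltn_trans lt_st lt_v; rewrite lt_vt andbT strict //.
  exact: avail (ltn_trans lt_tk lt_vt) (ltnW lt_k).
exists (s k); rewrite !inE ?ltnn ?andbF // lt_st andbT.
by rewrite strict // avail // permK.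
Qed.

Lemma perm_step_inj s t : perm_step s =1 perm_step t -> s = t.
Proof.
move=> eq_st.
have eq_fix i : (s i == i) = (t i == i).
  by have := eq_st i; rewrite /perm_step; do 2!case: eqP.
have fixV (r : 'S_N) i : ((r^-1)%g i == i) = (r i == i).
  by rewrite eq_sym -eq_permV.
have eq_types i : ((s^-1)%g i < i) = ((t^-1)%g i < i) /\ (i < s i) = (i < t i).
  have := eq_st i; rewrite /perm_step eq_fix; case: eqP => [fix_t _|_ []-> -> //].
  have /eqP fix_s : s i == i by rewrite eq_fix fix_t.
  have [/eqP fixVs /eqP fixVt] : (s^-1)%g i == i /\ (t^-1)%g i == i.
    by rewrite !fixV fix_s fix_t.
  by rewrite fix_s fix_t fixVs fixVt.
have eq_unest i : i < s i -> unest i s = unest i t.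
  move=> lt_i; have := eq_st i; rewrite /perm_step -eq_fix.
  by rewrite -val_eqE (gtn_eqF lt_i) -(eq_types i).2 lt_i => -[].
have ltNgeE (r : 'S_N) i : (r i < i) = ~~ (i < r i) && (r i != i).
  by rewrite -val_eqE; case: ltngtP.
have eq_aexc i : (s i < i) = (t i < i).
  by rewrite !ltNgeE (eq_types i).2 eq_fix.
have eq_aexcV i : (i < (s^-1)%g i) = (i < (t^-1)%g i).
  have ltE (r : 'S_N) : (i < (r^-1)%g i) = ~~ ((r^-1)%g i < i) && (r i != i).
    by rewrite -fixV -val_eqE; case: ltngtP.
  by rewrite !ltE (eq_types i).1 eq_fix.
have eq_lnest i : s i < i -> lnest i s = lnest i t.
  move=> lt_i; have := eq_st i; rewrite /perm_step -eq_fix.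
  by rewrite -val_eqE (ltn_eqF lt_i) -(eq_types i).2 [i < s i]ltnNge (ltnW lt_i) => -[].
apply/permP => i; have [lt_i|lt_i|/val_inj fix_i] := ltngtP (s i) i.
- have [n] := ubnP (val i); elim: n => // n IHn in i lt_i *.
  rewrite ltnS => le_in.
  have eq_lt j : j < i -> s j < j -> s j = t j.
    by move=> lt_ji lt_j; apply: IHn => //; apply: leq_trans le_in.
  have lt_ti : t i < i by rewrite -eq_aexc.
  (* If the values differed at [i], [ltn_lnest] in one order or the other would strictly separate
     two equal labels. *)
  apply/val_inj; case: (ltngtP (s i) (t i)) => // lt_st; exfalso.
    have := ltnn (lnest i t); rewrite -{1}eq_lnest // ltn_lnest // => [v|j].
      by rewrite eq_aexcV.
    by rewrite -eq_aexc; apply: eq_lt.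
  have := ltnn (lnest i t); rewrite -{2}eq_lnest // ltn_lnest // => [v|j lt_ji lt_j].
    by rewrite eq_aexcV.
  by rewrite eq_lt.
- have [n] := ubnP (N - i); elim: n => // n IHn in i lt_i *.
  rewrite ltnS => le_in.
  have eq_gt j : i < j -> j < s j -> s j = t j.
    move=> lt_ij lt_j; apply: IHn => //; apply: leq_trans le_in.
    by rewrite ltn_sub2l.
  have lt_ti : i < t i by rewrite -(eq_types i).2.
  apply/val_inj; case: (ltngtP (s i) (t i)) => // lt_st; exfalso.
    have := ltnn (unest i t); rewrite -{2}eq_unest // ltn_unest // => [v|j lt_ji lt_j].
      by rewrite (eq_types v).1.
    by rewrite eq_gt.
  have := ltnn (unest i t); rewrite -{1}eq_unest // ltn_unest // => [v|j].
    by rewrite (eq_types v).1.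
  by rewrite -(eq_types j).2; apply: eq_gt.
by have := eq_fix i; rewrite fix_i eqxx => /esym/eqP->.
Qed.

Lemma code_inj : injective code.
Proof.
move=> s t /eq_in_map eq_st; apply: perm_step_inj => i.
by apply: eq_st; rewrite mem_enum.
Qed.

Lemma drop_enum_ord i : drop i (enum 'I_N) = i :: drop i.+1 (enum 'I_N).
Proof. by rewrite (drop_nth i) ?size_enum_ord // nth_ord_enum. Qed.

Lemma next_perm_step s i : next_height (height s i) (perm_step s i) = height s i.+1.
Proof.
rewrite /next_height /perm_step; have := height_step s i.
case: eqP => [fix_i|_] /=; last by move=> <-; rewrite addnK.
have fixV : (s^-1)%g i = i by rewrite -{1}fix_i permK.
by rewrite fixV fix_i ltnn !addn0.
Qed.

Lemma perm_step_steps s i : perm_step s i \in steps (height s i).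
Proof.
apply: mem_steps; rewrite /perm_step; case: eqP => //= /eqP neq_i.
have [lt_i|lt_i|/val_inj fix_i] := ltngtP i (s i).
- have := unest_ucross lt_i; rewrite andbT; case: (_ < i) => /=; lia.
- have := lnest_lcross lt_i; rewrite andbF; lia.
by rewrite -fix_i eqxx in neq_i.
Qed.

Lemma code_codes s : code s \in codes N 0.
Proof.
suff suffix (k : nat) : k <= N ->
    [seq perm_step s i | i <- drop k (enum 'I_N)] \in codes (N - k) (height s k).
  by have := suffix 0 (leq0n N); rewrite drop0 subn0 height0.
have [n] := ubnP (N - k).
elim: n k => // n IHn k; rewrite ltnS => le_n le_kN.
have [lt_kN|] := ltnP k N; last first.
  move=> le_Nk; have -> : k = N by apply/eqP; rewrite eqn_leq le_kN.
  by rewrite subnn heightN /= drop_oversize ?size_enum_ord.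
pose i := Ordinal lt_kN; rewrite -[k]/(val i) -subnSK // (drop_enum_ord i).
apply: cons_codes; first exact: perm_step_steps.
by rewrite next_perm_step IHn //; move: le_n; rewrite /= -subnSK.
Qed.

(** An injective image of N! permutations inside a list of length N! exhausts it and leaves no room
    for repetitions. *)
Lemma perm_codes : perm_eq [seq code s | s : 'S_N] (codes N 0).
Proof.
have uniq_codes : uniq [seq code s | s : 'S_N].
  by rewrite map_inj_uniq ?enum_uniq //; apply: code_inj.
have sub_codes : {subset [seq code s | s : 'S_N] <= codes N 0}.
  by move=> _ /mapP[s _ ->]; apply: code_codes.
have le_size : size (codes N 0) <= size [seq code s | s : 'S_N].
  by rewrite size_codes bin0 muln1 size_map -cardE card_Sn.
have [_ eq_codes] := uniq_min_size uniq_codes sub_codes le_size.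
by apply: uniq_perm => //; apply: leq_size_uniq le_size.
Qed.

End PermCode.

Local Open Scope ring_scope.

(** * T-fractions and lattice paths *)

Section PowerSeries.
Variable R : comNzRingType.
Implicit Types f g : fps R.

Lemma eq_fps_mul f f' g g' : f =1 f' -> g =1 g' -> fps_mul f g =1 fps_mul f' g'.
Proof. by move=> ef eg n; apply: eq_bigr => i _; rewrite ef eg. Qed.

(** Truncation to polynomials carries the ring laws over to [fps_mul]. *)
Lemma fps_mul_coef f g n m : (n < m)%N ->
  fps_mul f g n = ((\poly_(i < m) f i) * (\poly_(i < m) g i))`_n.
Proof.
move=> lt_nm; rewrite coefM; apply: eq_bigr => -[i lt_in] _ /=.
by rewrite !coef_poly !(leq_ltn_trans _ lt_nm) ?leq_subr.
Qed.

Lemma fps_mulC f g : fps_mul f g =1 fps_mul g f.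
Proof. by move=> n; rewrite !(fps_mul_coef _ _ (ltnSn n)) mulrC. Qed.

Lemma fps_mulA f g (h : fps R) : fps_mul f (fps_mul g h) =1 fps_mul (fps_mul f g) h.
Proof.
move=> n; rewrite [RHS]fps_mulC.
pose p f := \poly_(i < n.+1) f i.
have mulE f1 f2 f3 : fps_mul f1 (fps_mul f2 f3) n = (p f1 * (p f2 * p f3))`_n.
  rewrite coefM; apply: eq_bigr => -[i lt_in] _ /=.
  by rewrite coef_poly lt_in (fps_mul_coef _ _ (_ : n - i < n.+1)%N) ?ltnS ?leq_subr.
by rewrite !mulE mulrA mulrC.
Qed.

Lemma fps_mul1 f : fps_mul (fps1 R) f =1 f.
Proof.
move=> n; rewrite /fps_mul big_ord_recl /fps1 mul1r subn0 big1 ?addr0 // => i _.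
by rewrite mul0r.
Qed.

Lemma fps_mul_step d a f g n :
  fps_mul (fps_step d a f) g n =
    if n is m.+1 then d * g m + a * fps_mul f g m else 0.
Proof.
rewrite /fps_mul big_ord_recl /= mul0r add0r.
case: n => [|n]; first by rewrite big_ord0.
under eq_bigr => i _ do rewrite subSS mulrDl -!mulrA.
by rewrite big_split /= -!mulr_sumr -/(fps_mul _ _ n) fps_mul1.
Qed.

Lemma fps_geomE f : f 0%N = 0 ->
  forall n, fps_geom f n = fps1 R n + fps_mul f (fps_geom f) n.
Proof.
move=> f0 n; rewrite -(fps_geomP f0 n) /fps_mul.
under eq_bigr => i _ do rewrite mulrBl.
by rewrite sumrB subrK -/(fps_mul _ _ n) fps_mul1.
Qed.

Section Convergents.
Variables (alpha delta : nat -> R) (K : nat).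

(** For [H' < K] every factor is cut off after the same level [K], so each factor is built from the
    next one by a single level of the fraction. *)
Fixpoint conv_prod (H : nat) : fps R :=
  if H is H'.+1 then
    fps_mul (conv_prod H') (Tconvergent alpha delta (K - H') H'.+1)
  else fps1 R.

(** The last factor F satisfies F = 1 + (delta t + alpha t f) F, where f is the next factor;
    multiply by the preceding factors. *)
Lemma conv_prod_rec H n : (H < K)%N ->
  conv_prod H.+1 n = conv_prod H n +
    (if n is m.+1 then
       delta H.+1 * conv_prod H.+1 m + alpha H.+1 * conv_prod H.+2 m
     else 0).
Proof.
move=> lt_HK; rewrite /=.
have -> : (K - H = (K - H.+1).+1)%N by lia.
set g := conv_prod H; set f := Tconvergent _ _ (K - H.+1) _ => /=.
set F := fps_geom _.
have FE : F =1 fun n => fps1 R n + fps_mul (fps_step (delta H.+1) (alpha H.+1) f) F n.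
  exact: fps_geomE.
have -> : fps_mul g F n =
    g n + fps_mul (fps_step (delta H.+1) (alpha H.+1) f) (fps_mul g F) n.
  rewrite (eq_fps_mul (frefl g) FE) {1}/fps_mul.
  under eq_bigr => i _ do rewrite mulrDr.
  rewrite big_split /= -/(fps_mul g (fps1 R) n) fps_mulC fps_mul1; congr (_ + _).
  rewrite -[LHS]/(fps_mul g (fps_mul _ F) n) fps_mulA [RHS]fps_mulA.
  by apply: eq_fps_mul => //; apply: fps_mulC.
congr (_ + _); rewrite fps_mul_step; case: n => // n.
by rewrite [fps_mul f _ _]fps_mulC.
Qed.

Lemma conv_prod0 H : (H < K)%N -> conv_prod H.+1 0 = conv_prod H 0.
Proof. by move=> lt_HK; rewrite conv_prod_rec ?addr0. Qed.

Lemma conv_prodS H n : (H < K)%N ->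
  conv_prod H.+1 n.+1 = conv_prod H n.+1 +
    (delta H.+1 * conv_prod H.+1 n + alpha H.+1 * conv_prod H.+2 n).
Proof. exact: conv_prod_rec. Qed.

End Convergents.

(** * Path sums as products of continued fractions *)

Section Transfer.
Variables up stay dn stay' : nat -> R.

(** [n] counts the remaining steps. Since the total length is even, [odd n'] means that the next
    index is odd: [up] and [stay] belong to odd indices, [dn] and [stay'] to even ones. *)
Fixpoint tot (n h : nat) : R :=
  if n is n'.+1 then
    if odd n' then up h * tot n' h.+1 + stay h * tot n' h
    else (if h is h'.+1 then dn h * tot n' h' else 0) + stay' h * tot n' h
  else (h == 0%N)%:R.

Lemma tot_even m h :
  tot (2 * m.+1) h = up h * tot (2 * m).+1 h.+1 + stay h * tot (2 * m).+1 h.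
Proof. by rewrite mulnS /= oddM. Qed.

Lemma tot_odd m h :
  tot (2 * m).+1 h =
  (if h is h'.+1 then dn h * tot (2 * m) h' else 0) + stay' h * tot (2 * m) h.
Proof. by rewrite /= oddM. Qed.

(** Only even indices lower the height, each by at most one. *)
Lemma tot_high m h :
  ((m < h)%N -> tot (2 * m) h = 0) /\ ((m.+1 < h)%N -> tot (2 * m).+1 h = 0).
Proof.
elim: m h => [|m IHm] h.
  by split; case: h => [|[|h]] // _; rewrite tot_odd muln0 /= !mulr0 addr0.
have even0 k : (m.+1 < k)%N -> tot (2 * m.+1) k = 0.
  by move=> lt_mk; rewrite tot_even !(IHm _).2 ?mulr0 ?addr0 // ltnS ltnW.
split; first exact: even0.
by case: h => // h lt_mh; rewrite tot_odd !even0 ?mulr0 ?addr0 // ltnW.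
Qed.

Variables alpha delta : nat -> R.
(** Each [alpha] is the weight of a rise times that of the fall back between two adjacent levels:
    [up k] leads from 2k to 2k+1 and [dn k.+1] back, [stay' k.+1] from 2k+1 to 2k+2 and [stay k.+1]
    back. *)
Hypothesis alpha_odd : forall k, alpha (2 * k).+1 = dn k.+1 * up k.
Hypothesis alpha_even : forall k, alpha (2 * k).+2 = stay' k.+1 * stay k.+1.
Hypothesis delta_1 : delta 1%N = stay' 0%N * stay 0%N.
Hypothesis delta_ge2 : forall n, (2 <= n)%N -> delta n = 0.

(* The generating function of the paths from level [H] down to 0, with the
   [H] final descents factored out, is the product of the continued fractions
   started at the levels 1, .., H.+1; the levels of the Dyck path are 2h after
   an even number of steps and 2h - 1 after an odd one. *)
Lemma tot_conv_prod K m h u : (2 * m + 3 <= K)%N -> (h + u = m)%N ->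
  let desc := \prod_(i < h) (stay i.+1 * dn i.+1) in
  tot (2 * m) h = desc * conv_prod alpha delta K (2 * h).+1 u /\
  tot (2 * m).+1 h.+1 =
    desc * dn h.+1 * conv_prod alpha delta K (2 * h).+2 u.
Proof.
pose desc i := \prod_(j < i) (stay j.+1 * dn j.+1); rewrite -/(desc h) /=.
pose even_case m := forall h u, (h + u = m)%N ->
  tot (2 * m) h = desc h * conv_prod alpha delta K (2 * h).+1 u.
have odd_case m' : (2 * m' + 3 <= K)%N -> even_case m' ->
    forall h u, (h + u = m')%N -> tot (2 * m').+1 h.+1 =
      desc h * dn h.+1 * conv_prod alpha delta K (2 * h).+2 u.
  move=> leK IH {}h {}u def_m; rewrite tot_odd (IH _ _ def_m).
  case: u def_m => [|u] def_m.
    (* The remaining steps just suffice for the final descents, so staying contributes nothing. *)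
    rewrite (tot_high _ _).1 ?mulr0 ?addr0; last by lia.
    by rewrite [in RHS]conv_prod0; [ring | lia].
  rewrite [in RHS]conv_prodS; last by lia.
  rewrite (IH h.+1 u); last by lia.
  by rewrite delta_ge2 // alpha_even mulnS /desc big_ord_recr /=; ring.
suff even_m : (2 * m + 3 <= K)%N -> even_case m.
  by move=> leK def_m; split; [apply: even_m | apply: odd_case => //; apply: even_m].
elim: m {h u} => [|m IHm] leK h u.
  case: h u => [|h] [|u] // _.
  by rewrite /desc big_ord0 mul1r conv_prod0 //; lia.
have leK' : (2 * m + 3 <= K)%N by lia.
have {}IHm := IHm leK'; rewrite tot_even.
case: h => [|h] def_m.
  rewrite add0n in def_m; rewrite {u}def_m muln0 conv_prodS; last by lia.
  rewrite (odd_case m leK' IHm 0%N m) // tot_odd (IHm 0%N m) //.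
  (* At height 0 the steps [stay] and [stay'] together return to level 0 through level -1, which is
     the [delta 1] term. *)
  rewrite delta_1 (alpha_odd 0) [conv_prod _ _ _ 0 _]/=.
  by rewrite /desc big_ord0 /fps1 /=; ring.
rewrite (odd_case m leK' IHm h u); last by lia.
case: u def_m => [|u] def_m.
  rewrite (tot_high _ _).2; last by lia.
  rewrite [in RHS]conv_prod0; last by lia.
  by rewrite mulnS /desc big_ord_recr /=; ring.
rewrite (odd_case m leK' IHm h.+1 u); last by lia.
rewrite [in RHS]conv_prodS; last by lia.
rewrite delta_ge2 // alpha_odd mulnS /desc big_ord_recr /=; ring.
Qed.

Lemma tot_Tfraction : is_Tfraction alpha delta (fun n => tot (2 * n) 0).
Proof.
(* This bound keeps [H < K] wherever the recursion of [conv_prod] is applied. *)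
move=> n; exists (2 * n + 3)%N => K leK.
have [-> _] := tot_conv_prod leK (add0n n).
by rewrite big_ord0 mul1r muln0 /= subn0 fps_mul1.
Qed.

End Transfer.
End PowerSeries.

(** * Weights *)

Section Weights.
Variable R : comNzRingType.

(** [m] is the number of crossings and nestings together, [l] that of nestings; [l = 0]
    characterizes records, resp. antirecords. *)
Definition arc_weight (p q y v : R) (m l : nat) : R :=
  p ^+ (m - l) * q ^+ l * (if l == 0%N then y else v).

Lemma sum_arc_weight p q y v m :
  \sum_(l < m.+1) arc_weight p q y v m l = p ^+ m * y + q * pq_nat p q m * v.
Proof.
rewrite big_ord_recl /arc_weight subn0 mulr1; congr (_ + _).
(* The order is reversed because [pq_nat] indexes its terms by the exponent of p, whereas [l] is the
   exponent of q. *)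
rewrite /pq_nat (reindex_inj rev_ord_inj) mulr_sumr mulr_suml.
apply: eq_bigr => -[l lt_lm] _ /=; rewrite /bump /=.
rewrite (_ : (m - (1 + (m - l.+1)))%N = l); last by lia.
rewrite (_ : (1 + (m - l.+1))%N = (m - 1 - l).+1); last by lia.
by rewrite exprS; ring.
Qed.

Lemma expr_card (I : finType) (P : pred I) (x : R) :
  x ^+ #|[set i | P i]| = \prod_i (if P i then x else 1).
Proof. by rewrite -big_mkcond prodr_const cardsE. Qed.

Lemma expr_sum_if (I : finType) (P : pred I) (F : I -> nat) (x : R) :
  x ^+ (\sum_(i | P i) F i)%N = \prod_i (if P i then x ^+ F i else 1).
Proof. by rewrite -big_mkcond expr_sum. Qed.

Variables x1 x2 y1 y2 u1 u2 v1 v2 we wo ze zo : R.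
Variables pm1 pm2 pp1 pp2 qm1 qm2 qp1 qp2 se so : R.

Definition up_weight (h : nat) : R := pp1 ^+ h * y1 + qp1 * pq_nat pp1 qp1 h * v1.

Definition odd_stay_weight (h : nat) : R :=
  if h is h'.+1 then
    pp2 ^+ h' * y2 + qp2 * pq_nat pp2 qp2 h' * v2 + so ^+ h * wo
  else zo.

Definition down_weight (h : nat) : R :=
  pm1 ^+ h.-1 * x1 + qm1 * pq_nat pm1 qm1 h.-1 * u1.

Definition even_stay_weight (h : nat) : R :=
  if h is h'.+1 then
    pm2 ^+ h' * x2 + qm2 * pq_nat pm2 qm2 h' * u2 + se ^+ h * we
  else ze.

(** Weight 0 for a type that does not fit the parity of its index is what restricts a sum over all
    codes to D-permutations. *)
Definition step_weight (is_odd : bool) (h : nat) (x : step) : R :=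
  match x with
  | (Some (closes, opens), l) =>
    if opens != is_odd then 0 else
    match closes, opens with
    | false, true => arc_weight pp1 qp1 y1 v1 h l
    | true, true => arc_weight pp2 qp2 y2 v2 h.-1 l
    | true, false => arc_weight pm1 qm1 x1 u1 h.-1 l
    | false, false => arc_weight pm2 qm2 x2 u2 h.-1 l
    end
  | (None, _) =>
    if h == 0%N then (if is_odd then zo else ze)
    else if is_odd then so ^+ h * wo else se ^+ h * we
  end.

Fixpoint code_weight (h : nat) (c : seq step) : R :=
  if c is x :: c' then
    step_weight (odd (size c')) h x * code_weight (next_height h x) c'
  else 1.

Lemma size_mem_codes n h c : c \in codes n h -> size c = n.
Proof.
elim: n h c => [|n IHn] h c; first by case: h => //; rewrite inE => /eqP->.
by rewrite codesS => /flatten_mapP[x _ /mapP[c' /IHn <- ->]].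
Qed.

Lemma sum_code_weight n h :
  \sum_(c <- codes n h) code_weight h c =
  tot up_weight odd_stay_weight down_weight even_stay_weight n h.
Proof.
elim: n h => [|n IHn] h; first by case: h => [|h]; rewrite ?big_seq1 ?big_nil.
rewrite codesS big_flatten big_map.
have -> : \sum_(x <- steps h) \sum_(c <- [seq x :: c | c <- codes n (next_height h x)])
    code_weight h c = \sum_(x <- steps h) step_weight (odd n) h x *
      tot up_weight odd_stay_weight down_weight even_stay_weight n (next_height h x).
  apply: eq_bigr => x _; rewrite big_map -IHn mulr_sumr; apply: eq_big_seq => c.
  by move/size_mem_codes => /= ->.
rewrite big_steps /next_height /= -!mulr_suml !addn0 addn1 !subn0 !subn1 /=.
(* For either parity, the two arc types that do not fit it vanish. *)
case: (odd n); rewrite /= ?sum_arc_weight.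
  case: h => [|h]; rewrite ?big_ord0 /=.
    by rewrite !mul0r !add0r.
  rewrite sum_arc_weight !(big1 _ _ _ (fun _ _ => erefl)) /up_weight; ring.
rewrite !(big1 _ _ _ (fun _ _ => erefl)).
case: h => [|h]; rewrite ?big_ord0 /=.
  by rewrite !mul0r !add0r.
by rewrite !sum_arc_weight /down_weight /=; ring.
Qed.

Lemma code_weight_prod N (s : 'S_N) :
  code_weight 0 (code s) =
  \prod_(i < N) step_weight (odd (N - i.+1)) (height s i) (perm_step s i).
Proof.
suff suffix (k : nat) : (k <= N)%N ->
    code_weight (height s k) [seq perm_step s i | i <- drop k (enum 'I_N)] =
    \prod_(i <- drop k (enum 'I_N))
      step_weight (odd (N - i.+1)) (height s i) (perm_step s i).
  by have := suffix 0%N (leq0n N); rewrite drop0 height0 big_enum.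
have [n] := ubnP (N - k).
elim: n k => // n IHn k; rewrite ltnS => le_n le_kN.
have [lt_kN|le_Nk] := ltnP k N; last first.
  by rewrite drop_oversize ?size_enum_ord //= big_nil.
pose i := Ordinal lt_kN; rewrite -[k]/(val i) drop_enum_ord big_cons /=.
rewrite -[height s k]/(height s i) next_perm_step IHn //=.
  by rewrite size_map size_drop size_enum_ord.
by move: le_n; rewrite -subnSK.
Qed.

(** The left side collects the contribution of [i] to all 22 exponents. The height is replaced by
    nestings plus crossings, so that [m - l] in [arc_weight] becomes the number of crossings. *)
Lemma perm_step_weight N (s : 'S_N) (i : 'I_N) : Dperm s ->
  (if earec s i && cpeak s i then x1 else 1) *
  (if earec s i && cdfall s i then x2 else 1) *
  (if erec s i && cval s i then y1 else 1) *
  (if erec s i && cdrise s i then y2 else 1) *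
  (if nrar s i && cpeak s i then u1 else 1) *
  (if nrar s i && cdfall s i then u2 else 1) *
  (if nrar s i && cval s i then v1 else 1) *
  (if nrar s i && cdrise s i then v2 else 1) *
  (if [&& even_idx i, fix_ s i & nrar s i] then we else 1) *
  (if [&& odd_idx i, fix_ s i & nrar s i] then wo else 1) *
  (if even_idx i && rar s i then ze else 1) *
  (if odd_idx i && rar s i then zo else 1) *
  (if cpeak s i then pm1 ^+ lcross i s else 1) *
  (if cdfall s i then pm2 ^+ lcross i s else 1) *
  (if cval s i then pp1 ^+ ucross i s else 1) *
  (if cdrise s i then pp2 ^+ ucross i s else 1) *
  (if cpeak s i then qm1 ^+ lnest i s else 1) *
  (if cdfall s i then qm2 ^+ lnest i s else 1) *
  (if cval s i then qp1 ^+ unest i s else 1) *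
  (if cdrise s i then qp2 ^+ unest i s else 1) *
  (if even_idx i && fix_ s i then se ^+ psnest i s else 1) *
  (if odd_idx i && fix_ s i then so ^+ psnest i s else 1) =
  step_weight (odd_idx i) (height s i) (perm_step s i).
Proof.
move=> /forallP/(_ i) Di; rewrite /perm_step /earec /erec /rar /nrar.
rewrite /cpeak /cdfall /cval /cdrise /fix_ /even_idx -/(odd_idx i).
have eqVi : ((s^-1)%g i == i) = (s i == i) by rewrite eq_sym -eq_permV.
have [lt_i|lt_i|/val_inj fix_i] := ltngtP i (s i).
- have neq_i : (s i == i) = false by rewrite -val_eqE (gtn_eqF lt_i).
  have odd_i : odd_idx i by move: Di; case: ifP => // _; rewrite leqNgt lt_i.
  rewrite neq_i odd_i /= exc_antirecord // exc_record //.
  have := unest_ucross lt_i.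
  have : (i < (s^-1)%g i)%N = ~~ ((s^-1)%g i < i)%N.
    by have := eqVi; rewrite neq_i -val_eqE; case: ltngtP.
  move=> ->; case: (_ < i)%N => /= <-; rewrite /arc_weight ?addn0 ?addn1 /= addKn;
    case: eqP => _ /=; ring.
- have neq_i : (s i == i) = false by rewrite -val_eqE (ltn_eqF lt_i).
  have odd_i : odd_idx i = false by move: Di; case: ifP => // _; rewrite leqNgt lt_i.
  rewrite neq_i odd_i /= aexc_antirecord // aexc_record //.
  have := lnest_lcross lt_i.
  have : (i < (s^-1)%g i)%N = ~~ ((s^-1)%g i < i)%N.
    by have := eqVi; rewrite neq_i -val_eqE; case: ltngtP.
  move=> ->; case: (_ < i)%N => /= <-; rewrite /arc_weight /= addKn;
    case: eqP => _ /=; ring.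
have fix_si := esym fix_i.
have fixV : (s^-1)%g i = i by apply/eqP; rewrite eqVi fix_si.
rewrite fixV fix_si eqxx ltnn /= fix_record // fix_antirecord // psnest_height //.
by case: (odd_idx i); case: eqP => [->|_] /=; ring.
Qed.

Lemma perm_step_weight0 N (s : 'S_N) : ~~ Dperm s ->
  \prod_(i < N) step_weight (odd_idx i) (height s i) (perm_step s i) = 0.
Proof.
case/forallPn => i Di; apply/eqP; rewrite (bigD1 i) //= /perm_step.
rewrite -val_eqE /=; move: Di; case: (odd_idx i).
  by rewrite -ltnNge => lt_i; rewrite (ltn_eqF lt_i) /= ltnNge ltnW //= mul0r.
by rewrite -ltnNge => lt_i; rewrite (gtn_eqF lt_i) /= lt_i /= mul0r.
Qed.

End Weights.

Theorem theorem3p9 (R : comNzRingType)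
  (x1 x2 y1 y2 u1 u2 v1 v2 we wo ze zo : R)
  (pm1 pm2 pp1 pp2 qm1 qm2 qp1 qp2 se so : R)
  (P : nat -> R) (alpha delta : nat -> R)
  (P_def : forall n : nat, P n =
    \sum_(s : 'S_(2 * n) | Dperm s)
      (x1 ^+ eareccpeak s * x2 ^+ eareccdfall s *
       y1 ^+ ereccval s * y2 ^+ ereccdrise s *
       u1 ^+ nrcpeak s * u2 ^+ nrcdfall s *
       v1 ^+ nrcval s * v2 ^+ nrcdrise s *
       we ^+ evennrfix s * wo ^+ oddnrfix s *
       ze ^+ evenrar s * zo ^+ oddrar s *
       pm1 ^+ lcrosscpeak s * pm2 ^+ lcrosscdfall s *
       pp1 ^+ ucrosscval s * pp2 ^+ ucrosscdrise s *
       qm1 ^+ lnestcpeak s * qm2 ^+ lnestcdfall s *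
       qp1 ^+ unestcval s * qp2 ^+ unestcdrise s *
       se ^+ epsnest s * so ^+ opsnest s))
  (alpha_odd : forall k : nat, (1 <= k)%N ->
    alpha (2 * k - 1)%N =
      (pm1 ^+ (k - 1) * x1 + qm1 * pq_nat pm1 qm1 (k - 1) * u1) *
      (pp1 ^+ (k - 1) * y1 + qp1 * pq_nat pp1 qp1 (k - 1) * v1))
  (alpha_even : forall k : nat, (1 <= k)%N ->
    alpha (2 * k)%N =
      (pm2 ^+ (k - 1) * x2 + qm2 * pq_nat pm2 qm2 (k - 1) * u2
         + se ^+ k * we) *
      (pp2 ^+ (k - 1) * y2 + qp2 * pq_nat pp2 qp2 (k - 1) * v2
         + so ^+ k * wo))
  (delta_1 : delta 1%N = ze * zo)
  (delta_ge2 : forall n : nat, (2 <= n)%N -> delta n = 0) :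
  is_Tfraction alpha delta P.
Proof.
pose W := code_weight x1 x2 y1 y2 u1 u2 v1 v2 we wo ze zo
  pm1 pm2 pp1 pp2 qm1 qm2 qp1 qp2 se so.
pose up := up_weight y1 v1 pp1 qp1.
pose stay := odd_stay_weight y2 v2 wo zo pp2 qp2 so.
pose dn := down_weight x1 u1 pm1 qm1.
pose stay' := even_stay_weight x2 u2 we ze pm2 qm2 se.
have P_tot n : P n = tot up stay dn stay' (2 * n) 0.
  rewrite -sum_code_weight -(perm_big _ (perm_codes _)) big_map big_enum /= P_def.
  (* The sum is extended to all permutations, those outside the D-permutations having weight 0 by
     [perm_step_weight0]. *)
  rewrite big_mkcond; apply: eq_bigr => s _; rewrite code_weight_prod.
  under [RHS]eq_bigr => i _.
    rewrite (_ : odd (2 * n - i.+1) = odd_idx i); last first.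
      by rewrite oddB // oddM.
    over.
  case: ifP => [Ds|/negbT nDs]; last by rewrite perm_step_weight0.
  rewrite /eareccpeak /eareccdfall /ereccval /ereccdrise /nrcpeak /nrcdfall.
  rewrite /nrcval /nrcdrise /evennrfix /oddnrfix /evenrar /oddrar.
  rewrite /lcrosscpeak /lcrosscdfall /ucrosscval /ucrosscdrise.
  rewrite /lnestcpeak /lnestcdfall /unestcval /unestcdrise /epsnest /opsnest.
  rewrite !expr_card !expr_sum_if -!big_split.
  by apply: eq_bigr => i _; rewrite /= -perm_step_weight.
have cf : is_Tfraction alpha delta (fun n => tot up stay dn stay' (2 * n) 0).
  apply: tot_Tfraction => [k|k||//].
  - have := alpha_odd k.+1 isT; rewrite (_ : (2 * k.+1 - 1)%N = (2 * k).+1); last by lia.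
    by rewrite subn1.
  - by have := alpha_even k.+1 isT; rewrite mulnS subn1.
  by rewrite delta_1.
by move=> n; have [K0 cvgK] := cf n; exists K0 => K /cvgK->.
Qed.
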